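(* Fix $\varepsilon\in(0,1)$ and put $\mu=\frac{\ln\varepsilon}{\pi}$. For each even integer $n\ge 2$ let $p=p_n=2\arctan\left(\varepsilon^{1/n}\right)\in\left(0,\frac{\pi}{2}\right)$ and define the points $$x_i=x_i^{(n)}=\frac{1}{p_n}\sin^{-1}\left(\sin(p_n)\cos\left(\frac{i\pi}{n}\right)\right),\qquad 0\le i\le n.$$ Let $\Delta x_i=|x_{i+1}-x_i|$ for $0\le i\le n-1$, and let $\Delta x_{\max}$ and $\Delta x_{\min}$ denote respectively the largest and the smallest of the numbers $\Delta x_0,\dots,\Delta x_{n-1}$ (all depending on $n$). Then for every fixed integer $i\ge 0$, $$\lim_{n\to\infty}\frac{\Delta x_i}{\Delta x_{\max}}=\sqrt{(i+1)^2+\mu^2}-\sqrt{i^2+\mu^2},$$ and in particular $$\lim_{n\to\infty}\frac{\Delta x_{\min}}{\Delta x_{\max}}=\sqrt{1+\mu^2}-|\mu|\neq 0,$$ where the limits are taken over even $n$.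
   Context: Here $\sin^{-1}$ is the principal branch of arcsine with values in $[-\pi/2,\pi/2]$. The points $x_i$ are the images of the Chebyshev points $y_i=\cos(i\pi/n)$ under the map $y\mapsto \frac1p\sin^{-1}(y\sin p)$, which is the inverse on $[-1,1]$ of $x\mapsto \frac{\sin(px)}{\sin(p)}$. They serve as interpolation points in $[-1,1]$ for the nonperiodic trigonometric basis $\psi_k(x)=T_k\left(\frac{\sin(px)}{\sin p}\right)$, where $T_k$ is the Chebyshev polynomial of the first kind. Since $n$ is even, $x_{n/2}=0$; the largest gap is the central one, $\Delta x_{\max}=|x_{n/2}-x_{n/2-1}|$, and the smallest gap is $\Delta x_{\min}=\Delta x_0$. *)

(* Defs.v *)
From Stdlib Require Import Reals RList List Arith.
From Coquelicot Require Import Coquelicot.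

Open Scope R_scope.

Definition mu (eps : R) : R := ln eps / PI.

Definition map_param (eps : R) (n : nat) : R :=
  2 * atan (Rpower eps (/ INR n)).

Definition node (eps : R) (n i : nat) : R :=
  / map_param eps n *
  asin (sin (map_param eps n) * cos (INR i * PI / INR n)).

Definition gap (eps : R) (n i : nat) : R :=
  Rabs (node eps n (S i) - node eps n i).

(* [seq 0 n] is the list 0, ..., n - 1. For n >= 1, [MaxRlist] and [MinRlist]
   return the true maximum and minimum; their default values only concern the
   empty list, i.e. n = 0. *)
Definition gap_max (eps : R) (n : nat) : R :=
  MaxRlist (map (gap eps n) (seq 0 n)).

Definition gap_min (eps : R) (n : nat) : R :=
  MinRlist (map (gap eps n) (seq 0 n)).

(* Convergence of u n to l as n tends to infinity through the even integers. *)
Definition is_lim_even (u : nat -> R) (l : R) : Prop :=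
  filterlim u (within Nat.Even eventually) (locally l).

(* Main.v *)
Require Import Defs.
From Stdlib Require Import Reals RList List Arith Lra Lia.
From Coquelicot Require Import Coquelicot.

Open Scope R_scope.

(** Put [h = PI / n], [m = mu eps], and let [s], [c] be the sine and the cosine of
    [p]. The angles [asin (s cos t)] have speed [s sin t / sqrt (1 - s^2 cos^2 t)],
    which increases on [[0, PI/2]]; by the mean value theorem and the symmetry
    [t -> PI - t], the largest gap is the central one and the smallest is the first.
    For [t] in [[0, PI/2]], [asin (s cos t) = PI/2 - asin (sqrt (c^2 + s^2 sin^2 t))].
    Since [p = 2 atan (exp (m h))], one has [s -> 1] and [c / h -> -m], so at [t = i h]
    the inner arcsine is equivalent to [h sqrt (m^2 + i^2)], while the central gap
    is [asin (s sin h) / p], with numerator equivalent to [h]. *)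

(** * Angles of the nodes and their speed *)

Definition angle (s t : R) : R := asin (s * cos t).

(** Minus the derivative of [angle s], the sign making it nonnegative on [[0, PI/2]]. *)
Definition angle_speed (s t : R) : R := s * sin t / sqrt (1 - (s * cos t)²).

Lemma derivable_pt_lim_asin (x : R) :
  -1 < x < 1 -> derivable_pt_lim asin x (/ sqrt (1 - x²)).
Proof.
intros Hx.
apply (derive_pt_eq_1 asin x _ (derivable_pt_asin x Hx)).
rewrite derive_pt_asin. unfold Rdiv; ring.
Qed.

Lemma scaled_cos_bound (s t : R) : 0 < s < 1 -> -1 < s * cos t < 1.
Proof. intros Hs; generalize (COS_bound t); nra. Qed.

Lemma scaled_cos_sqr_lt_1 (s t : R) : 0 < s < 1 -> 0 < 1 - (s * cos t)².
Proof. intros Hs; generalize (scaled_cos_bound s t Hs); unfold Rsqr; nra. Qed.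

Lemma derivable_pt_lim_angle (s t : R) :
  0 < s < 1 -> derivable_pt_lim (angle s) t (- angle_speed s t).
Proof.
intros Hs.
apply is_derive_Reals.
replace (- angle_speed s t)
  with (scal (s * - sin t) (/ sqrt (1 - (s * cos t)²)))
  by (unfold scal, angle_speed, Rdiv; simpl; unfold mult; simpl; ring).
apply (is_derive_comp asin (fun u => s * cos u)).
- apply is_derive_Reals, derivable_pt_lim_asin, scaled_cos_bound, Hs.
- auto_derive; [easy | ring].
Qed.

Lemma angle_speed_nonneg (s t : R) :
  0 < s < 1 -> 0 <= t <= PI / 2 -> 0 <= angle_speed s t.
Proof.
intros Hs Ht.
apply Rdiv_le_0_compat.
- apply Rmult_le_pos; [lra | apply sin_ge_0; lra].
- apply sqrt_lt_R0, scaled_cos_sqr_lt_1, Hs.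
Qed.

(* Its square is [s^2 q / (1 - s^2 + s^2 q)] with [q = sin t ^ 2]. *)
Lemma angle_speed_incr (s a b : R) :
  0 < s < 1 -> 0 <= a -> a <= b -> b <= PI / 2 ->
  angle_speed s a <= angle_speed s b.
Proof.
intros Hs Ha Hab Hb.
assert (Sa : 0 <= sin a) by (apply sin_ge_0; lra).
assert (Sab : sin a <= sin b) by (apply sin_incr_1; lra).
generalize (scaled_cos_sqr_lt_1 s a Hs) (scaled_cos_sqr_lt_1 s b Hs); intros Pa Pb.
apply Rsqr_incr_0;
  [| apply angle_speed_nonneg; lra | apply angle_speed_nonneg; lra].
unfold angle_speed; rewrite !Rsqr_div', !Rsqr_sqrt by lra.
apply (Rle_div_l _ _ _ Pa).
replace ((s * sin b)² / (1 - (s * cos b)²) * (1 - (s * cos a)²))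
  with ((s * sin b)² * (1 - (s * cos a)²) / (1 - (s * cos b)²)) by (field; lra).
apply (Rle_div_r _ _ _ Pb).
rewrite !Rsqr_mult, !cos2.
assert (Q : (sin a)² <= (sin b)²) by (apply Rsqr_incr_1; lra).
assert (Z : 0 < s² < 1) by (unfold Rsqr; nra).
assert (Q2 : 0 < s² * (1 - s²)) by (apply Rmult_lt_0_compat; lra).
set (x := (sin a)²) in *; set (y := (sin b)²) in *; set (z := s²) in *.
(* After cross-multiplication the two sides differ by exactly this product. *)
assert (0 <= z * (1 - z) * (y - x)) by nra.
lra.
Qed.

(** Mean value theorem; the strict location of [c] later allows the speeds of distinct gaps to be
    compared. *)
Lemma angle_increment (s a h : R) :
  0 < s < 1 -> 0 < h ->
  exists c, a < c < a + h /\ angle s a - angle s (a + h) = h * angle_speed s c.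
Proof.
intros Hs Hh.
destruct (MVT_cor2 (angle s) (fun t => - angle_speed s t) a (a + h)) as [c [E Hc]].
- lra.
- intros c _; apply derivable_pt_lim_angle, Hs.
- exists c; split; [exact Hc|].
  replace (angle s a - angle s (a + h)) with (- (angle s (a + h) - angle s a)) by ring.
  rewrite E; ring.
Qed.

(** * Reflection and complement identities for the arcsine *)

Lemma angle_supplement (s t : R) : angle s (PI - t) = - angle s t.
Proof.
unfold angle; rewrite <- asin_opp; f_equal.
rewrite Rtrigo_facts.cos_pi_minus; ring.
Qed.

Lemma asin_nonneg (v : R) : 0 <= v <= 1 -> 0 <= asin v.
Proof.
intros Hv; destruct (asin_bound v) as [L _].
destruct (Rle_lt_dec 0 (asin v)) as [H | H]; [exact H|exfalso].
assert (N : sin (asin v) < 0) by (apply sin_lt_0_var; generalize PI_RGT_0; lra).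
rewrite sin_asin in N by lra; lra.
Qed.

(** Here [sqrt (1 - v²)] is [sin (acos v)], and [v >= 0] puts [acos v = PI / 2 - asin v] in the
    range where [asin] inverts [sin]. *)
Lemma asin_complement (v : R) :
  0 <= v <= 1 -> asin v = PI / 2 - asin (sqrt (1 - v²)).
Proof.
intros Hv.
rewrite <- sin_acos, (acos_asin v), asin_sin; try lra.
generalize (asin_nonneg v Hv) (asin_bound v) PI_RGT_0; lra.
Qed.

(** Rests on [1 - s² cos² t = c² + s² sin² t]. For small [t] and [p] near [PI / 2] the argument of
    the arcsine moves from near 1, where the derivative blows up, to near 0, where it is 1. *)
Lemma angle_eq_complement (p t : R) :
  0 < p < PI / 2 -> 0 <= t <= PI / 2 ->
  angle (sin p) t = PI / 2 - asin (sqrt ((cos p)² + (sin p * sin t)²)).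
Proof.
intros Hp Ht; unfold angle.
assert (S0 : 0 < sin p) by (apply sin_gt_0; lra).
assert (C0 : 0 <= cos t) by (apply cos_ge_0; lra).
generalize (SIN_bound p) (COS_bound t); intros Sp Ct.
assert (B : 0 <= sin p * cos t <= 1).
{ split; [apply Rmult_le_pos; lra|].
  rewrite <- (Rmult_1_l 1); apply Rmult_le_compat; lra. }
rewrite (asin_complement _ B).
do 3 f_equal.
rewrite !Rsqr_mult, (cos2 t), (cos2 p); ring.
Qed.

(** * Ordering of the gaps; the largest and the smallest one *)

Lemma map_param_bounds (eps : R) (n : nat) :
  0 < eps < 1 -> (1 <= n)%nat -> 0 < map_param eps n < PI / 2.
Proof.
intros He Hn; unfold map_param.
assert (N : 0 < / INR n) by (apply Rinv_0_lt_compat, lt_0_INR; lia).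
assert (T : 0 < Rpower eps (/ INR n) < 1).
{ unfold Rpower; split; [apply exp_pos|].
  rewrite <- exp_0; apply exp_increasing.
  assert (ln eps < 0) by (rewrite <- ln_1; apply ln_increasing; lra).
  nra. }
generalize (atan_increasing 0 _ (proj1 T)) (atan_increasing _ 1 (proj2 T)).
rewrite atan_0, atan_1; lra.
Qed.

Lemma gap_angle (eps : R) (n i : nat) :
  0 < eps < 1 -> (1 <= n)%nat ->
  gap eps n i = / map_param eps n *
    Rabs (angle (sin (map_param eps n)) (INR (S i) * PI / INR n) -
          angle (sin (map_param eps n)) (INR i * PI / INR n)).
Proof.
intros He Hn; destruct (map_param_bounds eps n He Hn) as [P0 _].
unfold gap, node, angle.
rewrite <- Rmult_minus_distr_l, Rabs_mult, (Rabs_pos_eq (/ _)); [reflexivity|].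
left; apply Rinv_0_lt_compat, P0.
Qed.

Lemma sin_map_param_bounds (eps : R) (n : nat) :
  0 < eps < 1 -> (1 <= n)%nat -> 0 < sin (map_param eps n) < 1.
Proof.
intros He Hn; destruct (map_param_bounds eps n He Hn) as [P0 P1].
split; [apply sin_gt_0; lra|].
rewrite <- sin_PI2; apply sin_increasing_1; lra.
Qed.

(** The reflection [t -> PI - t] sends node [i] to node [n - i], so it exchanges the endpoints of
    gap [i] with those of gap [n - 1 - i]. *)
Lemma gap_symmetric (eps : R) (n i : nat) :
  0 < eps < 1 -> (i < n)%nat -> gap eps n i = gap eps n (n - 1 - i).
Proof.
intros He Hi.
assert (N : INR n <> 0) by (apply not_0_INR; lia).
rewrite !gap_angle by (trivial; lia).
f_equal.
replace (INR (S (n - 1 - i)) * PI / INR n) with (PI - INR i * PI / INR n).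
2: { replace (S (n - 1 - i)) with (n - i)%nat by lia.
     rewrite minus_INR by lia; field; exact N. }
replace (INR (n - 1 - i) * PI / INR n) with (PI - INR (S i) * PI / INR n).
2: { replace (n - 1 - i)%nat with (n - S i)%nat by lia.
     rewrite minus_INR by lia; field; exact N. }
rewrite !angle_supplement; f_equal; ring.
Qed.

Lemma central_range (n i : nat) :
  (2 * i <= n)%nat -> (1 <= n)%nat -> 0 <= INR i * PI / INR n <= PI / 2.
Proof.
intros Hi Hn.
assert (N : 0 < INR n) by (apply lt_0_INR; lia).
generalize PI_RGT_0 (pos_INR i); intros P I.
split; [apply Rdiv_le_0_compat; [nra | exact N]|].
apply Rmult_le_reg_r with (INR n); [exact N|].
apply le_INR in Hi; rewrite mult_INR in Hi; simpl (INR 2) in Hi.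
field_simplify; nra.
Qed.

(** The condition [2 * S i <= n] keeps both endpoints in [[0, PI/2]], where the speed is nonnegative
    and the absolute value drops. *)
Lemma gap_eq_speed (eps : R) (n i : nat) :
  0 < eps < 1 -> (2 * S i <= n)%nat ->
  exists c, INR i * PI / INR n < c < INR (S i) * PI / INR n /\
    gap eps n i = / map_param eps n *
      (PI / INR n * angle_speed (sin (map_param eps n)) c).
Proof.
intros He Hi.
assert (N : 0 < INR n) by (apply lt_0_INR; lia).
assert (Hs := sin_map_param_bounds eps n He ltac:(lia)).
assert (H0 : 0 < PI / INR n) by (apply Rdiv_lt_0_compat; [exact PI_RGT_0 | exact N]).
destruct (angle_increment (sin (map_param eps n)) (INR i * PI / INR n) (PI / INR n) Hs H0)
  as [c [Hc E]].
replace (INR i * PI / INR n + PI / INR n) with (INR (S i) * PI / INR n) in *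
  by (rewrite S_INR; field; lra).
exists c; split; [exact Hc|].
rewrite (gap_angle eps n i He ltac:(lia)), Rabs_minus_sym, E, Rabs_pos_eq;
  [reflexivity|].
apply Rmult_le_pos; [lra|]; apply angle_speed_nonneg; [exact Hs|].
generalize (central_range n i ltac:(lia) ltac:(lia)) (central_range n (S i) Hi ltac:(lia)).
lra.
Qed.

Lemma gap_incr (eps : R) (n i j : nat) :
  0 < eps < 1 -> (i <= j)%nat -> (2 * S j <= n)%nat ->
  gap eps n i <= gap eps n j.
Proof.
intros He Hij Hj.
(* For [i = j] the two intermediate points would lie in the same interval, in unknown order. *)
destruct (Nat.eq_dec i j) as [-> | Hne]; [apply Rle_refl|].
destruct (gap_eq_speed eps n i He ltac:(lia)) as [c [Hc ->]].
destruct (gap_eq_speed eps n j He Hj) as [d [Hd ->]].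
assert (N : 0 < INR n) by (apply lt_0_INR; lia).
assert (Hs := sin_map_param_bounds eps n He ltac:(lia)).
apply Rmult_le_compat_l.
{ left; apply Rinv_0_lt_compat, map_param_bounds; [exact He | lia]. }
apply Rmult_le_compat_l.
{ apply Rdiv_le_0_compat; [left; exact PI_RGT_0 | exact N]. }
assert (INR (S i) * PI / INR n <= INR j * PI / INR n).
{ apply Rmult_le_compat_r; [left; apply Rinv_0_lt_compat, N|].
  apply Rmult_le_compat_r; [left; exact PI_RGT_0|]. apply le_INR; lia. }
generalize (central_range n i ltac:(lia) ltac:(lia)) (central_range n (S j) Hj ltac:(lia)).
intros; apply angle_speed_incr; lra.
Qed.

(** Gaps grow up to index [m - 1], whose right endpoint is the angle [PI / 2]; the other half
    follows by reflection. *)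
Lemma gap_bounds (eps : R) (m i : nat) :
  0 < eps < 1 -> (i < 2 * m)%nat ->
  gap eps (2 * m) 0 <= gap eps (2 * m) i <= gap eps (2 * m) (m - 1).
Proof.
intros He Hi.
destruct (Nat.lt_ge_cases i m) as [H | H].
- split; apply gap_incr; trivial; lia.
- rewrite (gap_symmetric eps (2 * m) i) by trivial.
  split; apply gap_incr; trivial; lia.
Qed.

Lemma gap_max_central (eps : R) (m : nat) :
  0 < eps < 1 -> (1 <= m)%nat -> gap_max eps (2 * m) = gap eps (2 * m) (m - 1).
Proof.
intros He Hm; unfold gap_max.
assert (I : In (gap eps (2 * m) (m - 1)) (map (gap eps (2 * m)) (seq 0 (2 * m)))).
{ apply in_map, in_seq; lia. }
apply Rle_antisym; [|apply MaxRlist_P1, I].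
(* The maximum of a nonempty list is a member, hence some gap, and [gap_bounds] applies to it. *)
assert (M := MaxRlist_P2 _ (ex_intro (fun y => In y _) _ I)).
apply in_map_iff in M; destruct M as [i [<- Hi]]; apply in_seq in Hi.
apply gap_bounds; [exact He | lia].
Qed.

(** Counterpart of [MaxRlist_P2]; nonemptiness excludes the default value. *)
Lemma MinRlist_In (l : list R) : l <> nil -> In (MinRlist l) l.
Proof.
induction l as [|a [|b l] IH]; intros H; [easy | now left |].
change (MinRlist (a :: b :: l)) with (Rmin a (MinRlist (b :: l))).
unfold Rmin; destruct (Rle_dec a (MinRlist (b :: l))); [now left|].
right; apply IH; easy.
Qed.

Lemma gap_min_outer (eps : R) (m : nat) :
  0 < eps < 1 -> (1 <= m)%nat -> gap_min eps (2 * m) = gap eps (2 * m) 0.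
Proof.
intros He Hm; unfold gap_min.
assert (I : In (gap eps (2 * m) 0) (map (gap eps (2 * m)) (seq 0 (2 * m)))).
{ apply in_map, in_seq; lia. }
apply Rle_antisym; [apply MinRlist_P1, I|].
assert (M := MinRlist_In (map (gap eps (2 * m)) (seq 0 (2 * m)))
   ltac:(intros E; rewrite E in I; exact I)).
apply in_map_iff in M; destruct M as [i [<- Hi]]; apply in_seq in Hi.
apply gap_bounds; [exact He | lia].
Qed.

(** * Limits of quotients by the step *)

(** Write [f w / h] as [(f w / w) * (w / h)]; since [f 0 = 0], the first factor is a difference
    quotient at 0. All first-order equivalents below come from this. *)
Lemma is_lim_seq_derive_0 (f : R -> R) (l c : R) (w h : nat -> R) :
  is_derive f 0 l -> f 0 = 0 ->
  eventually (fun n => w n <> 0) -> is_lim_seq w 0 ->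
  is_lim_seq (fun n => w n / h n) c ->
  is_lim_seq (fun n => f (w n) / h n) (l * c).
Proof.
intros Hf F0 Hw W0 Hc.
apply is_lim_seq_ext_loc with (fun n => f (w n) / w n * (w n / h n)).
{ revert Hw; apply filter_imp; intros n Hn; unfold Rdiv.
  transitivity (f (w n) * / h n * (/ w n * w n)); [ring|].
  rewrite Rinv_l by exact Hn; ring. }
apply (is_lim_seq_mult' _ _ l c); [|exact Hc].
apply is_lim_seq_spec; intros e.
apply is_derive_Reals in Hf; destruct (Hf e (cond_pos e)) as [d Hd].
apply is_lim_seq_spec in W0; generalize (filter_and _ _ Hw (W0 d)).
apply filter_imp; intros n [Hn Hb].
rewrite Rminus_0_r in Hb; generalize (Hd (w n) Hn Hb).
now rewrite F0, Rplus_0_l, Rminus_0_r.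
Qed.

Definition step (n : nat) : R := PI / INR n.

Lemma step_pos (n : nat) : (1 <= n)%nat -> 0 < step n.
Proof.
intros Hn; apply Rdiv_lt_0_compat; [exact PI_RGT_0 | apply lt_0_INR; lia].
Qed.

Lemma is_lim_seq_step : is_lim_seq step 0.
Proof.
replace (Finite 0) with (Rbar_mult PI 0) by (simpl; f_equal; ring).
apply (is_lim_seq_scal_l (fun n => / INR n) PI 0).
replace (Finite 0) with (Rbar_inv p_infty) by reflexivity.
apply is_lim_seq_inv; [exact is_lim_seq_INR | easy].
Qed.

(** Makes [p] a smooth function of the step alone, since [ln eps / n = mu eps * (PI / n)]. *)
Lemma map_param_step (eps : R) (n : nat) :
  map_param eps n = 2 * atan (exp (mu eps * step n)).
Proof.
unfold map_param, Rpower, mu, step; do 3 f_equal.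
unfold Rdiv.
transitivity (ln eps * / INR n * (/ PI * PI)); [|ring].
rewrite Rinv_l by (generalize PI_RGT_0; lra); ring.
Qed.

Lemma is_derive_param (m : R) :
  is_derive (fun h => 2 * atan (exp (m * h))) 0 m.
Proof.
auto_derive; [easy|].
rewrite Rmult_0_r, exp_0; field.
Qed.

Lemma is_lim_seq_map_param (eps : R) :
  is_lim_seq (map_param eps) (PI / 2).
Proof.
apply is_lim_seq_ext with (fun n => 2 * atan (exp (mu eps * step n))).
{ intros n; symmetry; apply map_param_step. }
replace (PI / 2) with (2 * atan (exp (mu eps * 0)))
  by (rewrite Rmult_0_r, exp_0, atan_1; lra).
apply (is_lim_seq_continuous (fun h => 2 * atan (exp (mu eps * h))));
  [|exact is_lim_seq_step].
apply continuity_pt_filterlim, (ex_derive_continuous (fun h => 2 * atan (exp (mu eps * h)))).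
exists (mu eps); apply is_derive_param.
Qed.

Lemma is_lim_seq_sin_map_param (eps : R) :
  is_lim_seq (fun n => sin (map_param eps n)) 1.
Proof.
rewrite <- sin_PI2.
apply is_lim_seq_continuous; [apply continuity_sin | apply is_lim_seq_map_param].
Qed.

Lemma eventually_step_neq_0 : eventually (fun n => step n <> 0).
Proof.
exists 1%nat; intros n Hn; apply Rgt_not_eq, step_pos, Hn.
Qed.

Lemma is_lim_seq_div_self (h : nat -> R) :
  eventually (fun n => h n <> 0) -> is_lim_seq (fun n => h n / h n) 1.
Proof.
intros H; apply is_lim_seq_ext_loc with (fun _ => 1); [|apply is_lim_seq_const].
revert H; apply filter_imp; intros n Hn; now field.
Qed.

(** As a function of the step, [p] has value [PI / 2] and derivative [mu eps] at 0, so [cos p]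
    vanishes there with derivative [- mu eps]. *)
Lemma is_lim_seq_cos_map_param (eps : R) :
  is_lim_seq (fun n => cos (map_param eps n) / step n) (- mu eps).
Proof.
apply is_lim_seq_ext
  with (fun n => cos (2 * atan (exp (mu eps * step n))) / step n).
{ intros n; now rewrite <- map_param_step. }
rewrite <- (Rmult_1_r (- mu eps)).
apply (is_lim_seq_derive_0 (fun h => cos (2 * atan (exp (mu eps * h))))).
- replace (- mu eps) with (scal (mu eps) (-1)) by (unfold scal; simpl; unfold mult; simpl; ring).
  apply (is_derive_comp cos (fun h => 2 * atan (exp (mu eps * h)))).
  + rewrite Rmult_0_r, exp_0, atan_1.
    replace (2 * (PI / 4)) with (PI / 2) by field.
    replace (-1) with (- sin (PI / 2)) by (rewrite sin_PI2; ring).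
    apply is_derive_Reals, derivable_pt_lim_cos.
  + apply is_derive_param.
- rewrite Rmult_0_r, exp_0, atan_1, <- cos_PI2; f_equal; field.
- exact eventually_step_neq_0.
- exact is_lim_seq_step.
- apply is_lim_seq_div_self, eventually_step_neq_0.
Qed.

Lemma is_lim_seq_sin_step (a : R) :
  is_lim_seq (fun n => sin (a * step n) / step n) a.
Proof.
replace (Finite a) with (Finite (a * 1)) by (f_equal; ring).
apply (is_lim_seq_derive_0 (fun h => sin (a * h))).
- auto_derive; [easy|]. rewrite Rmult_0_r, cos_0; ring.
- now rewrite Rmult_0_r, sin_0.
- exact eventually_step_neq_0.
- exact is_lim_seq_step.
- apply is_lim_seq_div_self, eventually_step_neq_0.
Qed.

Lemma is_derive_asin_0 : is_derive asin 0 1.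
Proof.
apply is_derive_Reals.
replace 1 with (/ sqrt (1 - 0²)) at 1
  by (unfold Rsqr; rewrite Rmult_0_l, Rminus_0_r, sqrt_1; field).
apply derivable_pt_lim_asin; lra.
Qed.

Lemma is_lim_seq_asin (w : nat -> R) (c : R) :
  eventually (fun n => w n <> 0) ->
  is_lim_seq (fun n => w n / step n) c ->
  is_lim_seq (fun n => asin (w n) / step n) c.
Proof.
intros Hw Hc; rewrite <- (Rmult_1_l c).
apply is_lim_seq_derive_0; trivial; [exact is_derive_asin_0 | exact asin_0 |].
(* That [w] tends to 0 follows from [w = (w / step) * step]. *)
replace (Finite 0) with (Finite (c * 0)) by (f_equal; ring).
apply is_lim_seq_ext_loc with (fun n => w n / step n * step n).
{ generalize eventually_step_neq_0; apply filter_imp; intros n Hn; now field. }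
apply is_lim_seq_mult'; [exact Hc | exact is_lim_seq_step].
Qed.

(** * Asymptotics of a gap of fixed index and of the central gap *)

(** The inner argument in [angle_eq_complement] at [t = i * step n]: the cosine of the angle of node
    [i]. *)
Definition complement_sin (eps : R) (i n : nat) : R :=
  sqrt ((cos (map_param eps n))² + (sin (map_param eps n) * sin (INR i * step n))²).

Lemma complement_sin_pos (eps : R) (i n : nat) :
  0 < eps < 1 -> (1 <= n)%nat -> 0 < complement_sin eps i n.
Proof.
intros He Hn; destruct (map_param_bounds eps n He Hn).
assert (0 < cos (map_param eps n)) by (apply cos_gt_0; lra).
apply sqrt_lt_R0; unfold Rsqr; nra.
Qed.

Lemma is_lim_seq_complement_sin (eps : R) (i : nat) :
  0 < eps < 1 ->
  is_lim_seq (fun n => complement_sin eps i n / step n)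
    (sqrt (INR i ^ 2 + mu eps ^ 2)).
Proof.
intros He.
apply is_lim_seq_ext_loc with (fun n => sqrt ((cos (map_param eps n) / step n) ^ 2 +
  (sin (map_param eps n) * (sin (INR i * step n) / step n)) ^ 2)).
{ exists 1%nat; intros n Hn; assert (H := step_pos n Hn).
  (* The fifth [step n] is the outer denominator, which has to pass under the root. *)
  unfold complement_sin; rewrite <- (sqrt_Rsqr (step n)) at 5 by lra.
  rewrite <- sqrt_div_alt by (apply Rlt_0_sqr; lra).
  f_equal; unfold Rsqr; field; lra. }
apply is_lim_seq_continuous.
{ apply continuity_pt_sqrt; nra. }
replace (INR i ^ 2 + mu eps ^ 2) with ((- mu eps) ^ 2 + (1 * INR i) ^ 2) by ring.
assert (sqr : forall u l, is_lim_seq u (Finite l) -> is_lim_seq (fun n => u n ^ 2) (l ^ 2)).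
{ intros u l H; apply (is_lim_seq_continuous (fun x => x ^ 2)); [|exact H].
  apply derivable_continuous_pt, derivable_pt_pow. }
apply is_lim_seq_plus'; apply sqr; [apply is_lim_seq_cos_map_param|].
apply is_lim_seq_mult'; [apply is_lim_seq_sin_map_param | apply is_lim_seq_sin_step].
Qed.

(** The two constants [PI / 2] cancel in the difference. *)
Lemma gap_eq_complement (eps : R) (n i : nat) :
  0 < eps < 1 -> (2 * S i <= n)%nat ->
  map_param eps n * gap eps n i =
  Rabs (asin (complement_sin eps (S i) n) - asin (complement_sin eps i n)).
Proof.
intros He Hi.
assert (P := map_param_bounds eps n He ltac:(lia)).
rewrite gap_angle by (trivial; lia).
rewrite !angle_eq_complement by (trivial; apply central_range; lia).
rewrite <- Rmult_assoc, Rinv_r, Rmult_1_l, Rabs_minus_sym by lra.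
unfold complement_sin, step, Rdiv; rewrite <- !Rmult_assoc.
f_equal; ring.
Qed.

Lemma is_lim_seq_gap (eps : R) (i : nat) :
  0 < eps < 1 ->
  is_lim_seq (fun n => map_param eps n * gap eps n i / step n)
    (sqrt ((INR i + 1) ^ 2 + mu eps ^ 2) - sqrt (INR i ^ 2 + mu eps ^ 2)).
Proof.
intros He.
set (l := _ - _).
(* Needed because the limit is taken through [Rabs] and must come out as [l] itself. *)
assert (L : 0 <= l).
{ assert (sqrt (INR i ^ 2 + mu eps ^ 2) <= sqrt ((INR i + 1) ^ 2 + mu eps ^ 2)).
  { apply sqrt_le_1_alt; generalize (pos_INR i); nra. }
  unfold l; lra. }
rewrite <- (Rabs_pos_eq l L).
apply is_lim_seq_ext_loc with (fun n => Rabs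
  (asin (complement_sin eps (S i) n) / step n - asin (complement_sin eps i n) / step n)).
{ exists (2 * S i)%nat; intros n Hn.
  rewrite gap_eq_complement by trivial.
  assert (H := step_pos n ltac:(lia)).
  rewrite <- (Rabs_pos_eq (step n)) at 3 by lra.
  rewrite <- Rabs_div by lra; f_equal; field; lra. }
apply (is_lim_seq_abs _ l).
unfold l; rewrite <- S_INR.
apply is_lim_seq_minus'; apply is_lim_seq_asin.
2, 4: now apply is_lim_seq_complement_sin.
all: exists 1%nat; intros n Hn; apply Rgt_not_eq, complement_sin_pos; trivial.
Qed.

(** Treated apart because its index moves with [n]. Node [m] is 0, and the preceding one has
    parameter [PI / 2 - step], whose cosine is [sin step]. *)
Lemma gap_central (eps : R) (m : nat) :
  0 < eps < 1 -> (1 <= m)%nat ->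
  map_param eps (2 * m) * gap eps (2 * m) (m - 1) =
  asin (sin (map_param eps (2 * m)) * sin (step (2 * m))).
Proof.
intros He Hm.
assert (P := map_param_bounds eps (2 * m) He ltac:(lia)).
assert (Hs := sin_map_param_bounds eps (2 * m) He ltac:(lia)).
assert (M : INR m <> 0) by (apply not_0_INR; lia).
assert (H0 := step_pos (2 * m) ltac:(lia)).
rewrite gap_angle by (trivial; lia).
rewrite <- Rmult_assoc, Rinv_r, Rmult_1_l by lra.
replace (S (m - 1)) with m by lia.
replace (INR m * PI / INR (2 * m)) with (PI / 2)
  by (rewrite mult_INR; simpl (INR 2); field; exact M).
replace (INR (m - 1) * PI / INR (2 * m)) with (PI / 2 - step (2 * m))
  by (unfold step; rewrite mult_INR, minus_INR by lia;
      simpl (INR 2); simpl (INR 1); field; exact M).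
unfold angle; rewrite cos_PI2, Rmult_0_r, asin_0, cos_shift, Rminus_0_l, Rabs_Ropp.
apply Rabs_pos_eq.
assert (S0 : 0 <= sin (step (2 * m))).
{ apply sin_ge_0; [lra|]; unfold step.
  replace (PI / INR (2 * m)) with (INR 1 * PI / INR (2 * m)) by (simpl; unfold Rdiv; ring).
  generalize (central_range (2 * m) 1 ltac:(lia) ltac:(lia)) PI_RGT_0; lra. }
assert (S1 := SIN_bound (step (2 * m))).
set (v := sin (map_param eps (2 * m)) * sin (step (2 * m))).
assert (V : 0 <= v <= 1).
{ split; [apply Rmult_le_pos; lra|].
  rewrite <- (Rmult_1_l 1); apply Rmult_le_compat; lra. }
apply asin_nonneg, V.
Qed.

Lemma is_lim_seq_central (eps : R) :
  0 < eps < 1 ->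
  is_lim_seq (fun n => asin (sin (map_param eps n) * sin (step n)) / step n) 1.
Proof.
intros He; apply is_lim_seq_asin.
(* At [n = 1] the step is [PI] and its sine vanishes. *)
- exists 2%nat; intros n Hn.
  assert (Hs := sin_map_param_bounds eps n He ltac:(lia)).
  assert (H := step_pos n ltac:(lia)).
  apply Rgt_not_eq, Rmult_lt_0_compat; [lra | apply sin_gt_0; [exact H|]].
  generalize (central_range n 1 ltac:(lia) ltac:(lia)) PI_RGT_0.
  unfold step; simpl (INR 1); rewrite Rmult_1_l; lra.
- replace (Finite 1) with (Finite (1 * 1)) by (f_equal; ring).
  apply is_lim_seq_ext with
    (fun n => sin (map_param eps n) * (sin (1 * step n) / step n)).
  { intros n; rewrite Rmult_1_l; unfold Rdiv; ring. }
  apply is_lim_seq_mult'; [apply is_lim_seq_sin_map_param | apply is_lim_seq_sin_step].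
Qed.

(** * Limits of the gap ratios along even [n] *)

Lemma is_lim_even_gap_ratio (eps : R) (i : nat) :
  0 < eps < 1 ->
  is_lim_even (fun n => gap eps n i / gap_max eps n)
    (sqrt ((INR i + 1) ^ 2 + mu eps ^ 2) - sqrt (INR i ^ 2 + mu eps ^ 2)).
Proof.
intros He; unfold is_lim_even.
set (l := _ - _).
apply filterlim_ext_loc with (fun n =>
  (map_param eps n * gap eps n i / step n) /
  (asin (sin (map_param eps n) * sin (step n)) / step n)).
(* Evenness identifies the largest gap with the central one; the common factor [p / step] then
   cancels. *)
{ exists 1%nat; intros n Hn [m ->].
  rewrite gap_max_central, <- gap_central by (trivial; lia).
  assert (H := step_pos (2 * m) Hn).
  assert (P := map_param_bounds eps (2 * m) He Hn).
  unfold Rdiv; rewrite !Rinv_mult, Rinv_inv.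
  transitivity (gap eps (2 * m) i * / gap eps (2 * m) (m - 1) *
    (map_param eps (2 * m) * / map_param eps (2 * m)) * (step (2 * m) * / step (2 * m)));
    [ring|].
  rewrite !Rinv_r by lra; ring. }
(* The rewritten quotient converges along all [n], hence along the even ones. *)
apply (@filterlim_filter_le_1 _ _ eventually).
{ intros Q; unfold within; apply filter_imp; now intros. }
replace l with (l / 1) by field.
apply (is_lim_seq_div' _ _ l 1); [now apply is_lim_seq_gap | now apply is_lim_seq_central | lra].
Qed.

Theorem mainTheorem1 (eps : R) (heps : 0 < eps < 1) :
  (forall n : nat, (2 <= n)%nat -> Nat.Even n ->
     0 < map_param eps n < PI / 2) /\
  (forall i : nat,
     is_lim_even (fun n => gap eps n i / gap_max eps n)
       (sqrt ((INR i + 1) ^ 2 + mu eps ^ 2) - sqrt (INR i ^ 2 + mu eps ^ 2))) /\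
  is_lim_even (fun n => gap_min eps n / gap_max eps n)
    (sqrt (1 + mu eps ^ 2) - Rabs (mu eps)) /\
  sqrt (1 + mu eps ^ 2) - Rabs (mu eps) <> 0.
Proof.
split; [|split; [|split]].
- intros n Hn _; apply map_param_bounds; [exact heps | lia].
- intros i; now apply is_lim_even_gap_ratio.
- unfold is_lim_even.
  apply filterlim_ext_loc with (fun n => gap eps n 0 / gap_max eps n).
  { exists 1%nat; intros n Hn [m ->]; now rewrite gap_min_outer by (trivial; lia). }
  (* The case [i = 0], where the second root is [sqrt (mu²) = Rabs mu]. *)
  replace (sqrt (1 + mu eps ^ 2) - Rabs (mu eps))
    with (sqrt ((INR 0 + 1) ^ 2 + mu eps ^ 2) - sqrt (INR 0 ^ 2 + mu eps ^ 2)).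
  + now apply is_lim_even_gap_ratio.
  + rewrite <- (sqrt_Rsqr_abs (mu eps)); f_equal; [|f_equal]; f_equal; unfold Rsqr; simpl; ring.
- apply Rgt_not_eq, Rlt_0_minus.
  rewrite <- sqrt_Rsqr_abs; apply sqrt_lt_1_alt; unfold Rsqr; nra.
Qed.
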